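(* If $T=[T_1,\ldots,T_n]$, $T_i\in B(\mathcal H)$, is a row contraction such that $T\notin C_{\cdot0}$ and $T\notin C_{\cdot1}$, then there is a non-trivial joint invariant subspace (different from $\{0\}$ and $\mathcal H$) under $T_1,\ldots,T_n$.
   Context: $n\in\{1,2,\ldots\}$ or $n=\infty$; $T=[T_1,\ldots,T_n]$ with $T_i$ bounded operators on a complex Hilbert space $\mathcal H$ is a row contraction if $\sum_iT_iT_i^*\le I$. $\mathbb F_n^+$ is the free semigroup with generators $g_1,\ldots,g_n$; for $\alpha=g_{i_1}\cdots g_{i_k}$, $|\alpha|=k$ and $T_\alpha=T_{i_1}\cdots T_{i_k}$. A row contraction $T$ is of class $C_{\cdot0}$ if $\lim_{k\to\infty}\sum_{|\alpha|=k}\|T_\alpha^*h\|^2=0$ for every $h\in\mathcal H$, and of class $C_{\cdot1}$ if $\lim_{k\to\infty}\sum_{|\alpha|=k}\|T_\alpha^*h\|^2\ne0$ for every $h\in\mathcal H$, $h\ne0$. Subspaces are closed. *)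

(* Defs.v *)
From HB Require Import structures.
From mathcomp Require Import all_boot all_order all_algebra.
From mathcomp Require Import all_classical all_reals all_analysis.
From mathcomp Require Import summability.
From mathcomp Require Import complex.

Set Implicit Arguments.
Unset Strict Implicit.
Unset Printing Implicit Defensive.

Import Order.TTheory GRing.Theory Num.Theory.
Import numFieldNormedType.Exports.

Local Open Scope classical_set_scope.
Local Open Scope ring_scope.

(* The inner product is linear in its first argument and conjugate-linear in
   its second one.  The norm of a normed module over R[i] has values in R[i]. *)
Record hilbertType (R : realType) := Hilbert {
  hilbert_sort :> completeNormedModType R[i];
  inner : {dot hilbert_sort for Num.conj};
  normE : forall x : hilbert_sort, `|x| ^+ 2 = inner x x }.

(* B(H); for linear maps continuity and boundedness agree by
   [linear_bounded_continuous]. *)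
Record bounded_op (R : realType) (H : hilbertType R) := BoundedOp {
  op_fun :> {linear H -> H};
  op_bounded : bounded_near op_fun (nbhs (0 : H)) }.

Section Operators.
Variables (R : realType) (H : hilbertType R).

Definition is_adjoint (A B : H -> H) : Prop :=
  forall x y : H, inner H (A x) y = inner H x (B y).

(* For a bounded A the set below is a singleton, by the Riesz representation
   theorem. *)
Definition adjoint (A : H -> H) : H -> H := get [set B | is_adjoint A B].

(* B - A is a positive operator; 0 <= z in R[i] means that z is real and
   nonnegative. *)
Definition op_le (A B : H -> H) : Prop :=
  forall x : H, 0 <= inner H (B x - A x) x.

Definition closed_subspace (M : set H) : Prop :=
  [/\ closed M, M 0
    & forall (a : R[i]) (x y : H), M x -> M y -> M (a *: x + y)].

End Operators.

(* The generators g_1, ..., g_m for n = Some m, and g_1, g_2, ... for n = None,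
   which stands for n = oo; the indices are shifted to start from 0.  The free
   semigroup F_n^+ (with its unit) is the type of words seq (gens n). *)
Definition gens (n : option nat) : countType :=
  match n with Some m => 'I_m | None => nat end.

Section Tuples.
Variables (R : realType) (H : hilbertType R) (n : option nat).
Variable T : gens n -> bounded_op H.

(* For n = oo, the series of operators converges in the strong operator
   topology. *)
Definition row_contraction : Prop :=
  exists2 S : bounded_op H,
    forall h : H,
      partial_sum (fun i => T i (adjoint (T i) h)) A @[A --> totally] --> S h
  & op_le S idfun.

Definition word_op (w : seq (gens n)) : H -> H :=
  foldr (fun i A => T i \o A) idfun w.

Definition word_sum (h : H) (k : nat) : \bar R :=
  \esum_(w in [set w : seq (gens n) | size w = k])
    (complex.Re `|adjoint (word_op w) h| ^+ 2)%:E.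

Definition class_C0 : Prop :=
  forall h : H, word_sum h k @[k --> \oo] --> 0%E.

Definition class_C1 : Prop :=
  forall h : H, h != 0 ->
    exists2 l : \bar R, word_sum h k @[k --> \oo] --> l & l != 0%E.

Definition joint_invariant (M : set H) : Prop :=
  forall (i : gens n) (x : H), M x -> M (T i x).

End Tuples.

(* Main.v *)
Require Import Defs.
From mathcomp Require Import all_boot all_order all_algebra finmap.
From mathcomp Require Import all_classical all_reals all_analysis.
From mathcomp Require Import complex summability ring lra.

(** Let [N] be the set of the vectors [h] such that the sums over words of
    length [k] of [|T_w^* h|^2] tend to [0] as [k] grows.  For a fixed [k]
    such a sum is the square of a seminorm in [h], and it is at most [|h|^2]
    since [T] is a row contraction; so [N] is a closed subspace
    ([closed_subspace_decays]).  It is invariant under every [T_i^*], because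
    [T_w^* T_i^* h] is [T_(iw)^* h], so that the sum of length [k] for
    [T_i^* h] is a part of the sum of length [k + 1] for [h]
    ([decays_adjoint]).  Hence the orthogonal complement of [N] is a closed
    subspace, invariant under every [T_i].

    It is not the whole space as soon as [N] has a nonzero vector, and it is
    not zero as soon as [N] is not the whole space, by the projection theorem
    ([orthogonal_nontrivial]).  The second condition is the negation of
    [class_C0].  The first one is the negation of [class_C1]: the sums
    decrease with [k], hence always converge, so that a nonzero [h] without a
    nonzero limit must lie in [N] ([not_decays_lim]).

    Both the monotonicity in [k] and the invariance of [N] come from the
    recursion [word_sumS], which splits off the first letter of a word:
    the sum of length [k + 1] for [h] is the sum over [i] of the sums of length
    [k] for [T_i^* h].

    The adjoint being a chosen value, its defining property rests on the
    existence of an adjoint, that is, on the Riesz representation theorem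
    ([riesz]), which is another consequence of the projection theorem. *)

Import Order.TTheory GRing.Theory Num.Theory.
Import numFieldNormedType.Exports.

Local Open Scope classical_set_scope.
Local Open Scope ring_scope.

(** * Hilbert spaces: projection, Riesz representation and adjoints *)

Section HilbertSpace.
Set Implicit Arguments.
Unset Strict Implicit.
Local Open Scope complex_scope.

Variables (R : realType) (H : hilbertType R).
Implicit Types (x y z u v : H) (e : R) (M : set H).

(** The norm of [H] has values in [R[i]], where the order is partial; infima and
    estimates are taken in [R]. *)
Definition rnorm x : R := complex.Re `|x|.

Lemma rnormE x : `|x| = (rnorm x)%:C.
Proof. by rewrite /rnorm RRe_real// normr_real. Qed.

Lemma rnorm_ge0 x : 0 <= rnorm x.
Proof. by rewrite -ler0c -rnormE. Qed.

Lemma inner_rnorm x : inner H x x = (rnorm x ^+ 2)%:C.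
Proof. by rewrite -normE rnormE rmorphXn. Qed.

Lemma rnorm_triangle x y z : rnorm (x - z) <= rnorm (x - y) + rnorm (y - z).
Proof. by rewrite -lecR rmorphD/= -!rnormE ler_distD. Qed.

Lemma rnormN x : rnorm (- x) = rnorm x.
Proof. by rewrite /rnorm normrN. Qed.

Lemma rnorm_distC x y : rnorm (x - y) = rnorm (y - x).
Proof. by rewrite -rnormN opprB. Qed.

Lemma parallelogram x y :
  rnorm (x + y) ^+ 2 + rnorm (x - y) ^+ 2 = 2 * (rnorm x ^+ 2 + rnorm y ^+ 2).
Proof.
apply: complexI; rewrite rmorphM !rmorphD/= -!inner_rnorm.
rewrite dnormD dnormB/=.
by rewrite rmorph1; ring.
Qed.

Lemma rnormZ_sqr (a : R[i]) x :
  rnorm (a *: x) ^+ 2 = complex.Re `|a| ^+ 2 * rnorm x ^+ 2.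
Proof.
rewrite -exprMn; congr (_ ^+ 2).
apply: complexI.
by rewrite rmorphM -!rnormE normrZ; congr (_ * _); rewrite [RHS]RRe_real// normr_real.
Qed.

Lemma inner_conj x y : inner H x y = (inner H y x)^*%R.
Proof. by have := hermC (inner H) x y; rewrite mul1r. Qed.

Lemma inner0r x : inner H x 0 = 0. Proof. exact: linear0r. Qed.

Lemma inner0l x : inner H 0 x = 0.
Proof. by rewrite inner_conj inner0r conjC0. Qed.

Lemma innerBl x y z : inner H (x - y) z = inner H x z - inner H y z.
Proof. exact: linearBl. Qed.

Lemma innerBr x y z : inner H x (y - z) = inner H x y - inner H x z.
Proof. exact: linearBr. Qed.

Lemma innerDl x y z : inner H (x + y) z = inner H x z + inner H y z.
Proof. exact: linearDl. Qed.

Lemma innerDr x y z : inner H x (y + z) = inner H x y + inner H x z.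
Proof. exact: linearDr. Qed.

Lemma innerPl (a : R[i]) x y z :
  inner H (a *: x + y) z = a * inner H x z + inner H y z.
Proof. exact: linearPl. Qed.

Lemma innerZl (a : R[i]) x y : inner H (a *: x) y = a * inner H x y.
Proof. exact: linearZl_LR. Qed.

Lemma innerZr (a : R[i]) x y : inner H x (a *: y) = a^*%R * inner H x y.
Proof. exact: linearZr_LR. Qed.

Lemma inner_eq0 x : inner H x x = 0 -> x = 0.
Proof. by move/eqP; rewrite dnorm_eq0 => /eqP. Qed.

(** Pythagoras for [x] and its projection on the line of [y].  Both the
    Cauchy-Schwarz inequality and the orthogonality at a minimal distance read
    off the sign of the subtracted term. *)
Lemma norm_sub_proj x y : y != 0 ->
  `|x - (inner H x y / `|y| ^+ 2) *: y| ^+ 2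
    = `|x| ^+ 2 - `|inner H x y| ^+ 2 / `|y| ^+ 2 :> R[i].
Proof.
move=> y0.
have n0 : `|y| ^+ 2 != 0 :> R[i] by rewrite expf_neq0 // normr_eq0.
set a := _ / _.
rewrite normE dnormB/= dnormZ -!normE.
have -> : inner H x (a *: y) = `|inner H x y| ^+ 2 / `|y| ^+ 2.
  rewrite innerZr /a rmorphM/= fmorphV/= rmorphXn/=.
  by rewrite (CrealP (normr_real y)) normCK; ring.
have -> : `|a| ^+ 2 = `|inner H x y| ^+ 2 / (`|y| ^+ 2) ^+ 2.
  rewrite /a normrM normfV exprMn exprVn; congr (_ / _ ^+ 2).
  by rewrite ger0_norm// exprn_ge0.
rewrite (CrealP _); last by rewrite realM ?realV ?rpredX// normr_real.
by field; rewrite normr_eq0.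
Qed.

Lemma cauchy_schwarz x y : `|inner H x y| <= `|x| * `|y| :> R[i].
Proof.
have [->|y0] := eqVneq y 0; first by rewrite inner0r !normr0 mulr0.
have y2_gt0 : 0 < `|y| ^+ 2 :> R[i] by rewrite exprn_gt0 // normr_gt0.
rewrite -(@ler_pXn2r _ 2) ?nnegrE ?mulr_ge0// exprMn -ler_pdivrMr //.
by rewrite -subr_ge0 -norm_sub_proj// exprn_ge0.
Qed.

Lemma nbhs_rnormP x (A : set H) :
  nbhs x A <-> exists2 e, 0 < e & forall y, rnorm (x - y) < e -> A y.
Proof.
split=> [/nbhs_normP[c /= c0 cA]|[e e0 eA]].
  have cE : c = (complex.Re c)%:C by rewrite RRe_real// gtr0_real.
  exists (complex.Re c); first by rewrite -ltcR -cE.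
  by move=> y xy; apply: cA; rewrite /= rnormE cE ltcR.
apply/nbhs_normP; exists e%:C; first by rewrite /= ltcR.
by move=> y /=; rewrite rnormE ltcR => /eA.
Qed.

Lemma closed_rnormP M : closed M <->
  forall x, (forall e, 0 < e -> exists2 y, M y & rnorm (x - y) < e) -> M x.
Proof.
split=> cM x.
  move=> xM; apply: cM => B /nbhs_rnormP[e /xM[y My xy] eB].
  by exists y; split => //; apply: eB.
move=> xM; apply: cM => e e0.
have /xM[y [My xy]] : nbhs x [set y | rnorm (x - y) < e].
  by apply/nbhs_rnormP; exists e.
by exists y.
Qed.

Lemma inner_small u e : 0 < e ->
  exists2 d, 0 < d & forall x, rnorm x < d -> `|inner H x u| < e%:C.
Proof.
move=> e0; have u1 : 0 < rnorm u + 1 by rewrite ltr_wpDl ?rnorm_ge0.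
exists (e / (rnorm u + 1)); first exact: divr_gt0.
move=> x xe; apply: le_lt_trans (cauchy_schwarz _ _) _.
rewrite !rnormE -rmorphM ltcR.
rewrite ltr_pdivlMr // in xe; apply: le_lt_trans xe.
by rewrite ler_wpM2l ?rnorm_ge0// lerDl.
Qed.

Definition orthogonal_to (N : set H) : set H :=
  [set x | forall u, N u -> inner H x u = 0].

Lemma closed_subspace_orthogonal (N : set H) :
  closed_subspace (orthogonal_to N).
Proof.
split=> [|u _|a x y Mx My u Nu].
- apply/closed_rnormP => x xM u Nu; apply: contrapT => /eqP xu.
  have e0 : 0 < complex.Re `|inner H x u|.
    by rewrite -ltcR RRe_real ?normr_real// normr_gt0.
  have [d d0 /(_ (x - _)) dP] := inner_small u e0.
  have [y /(_ u Nu) yu /dP] := xM d d0.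
  by rewrite innerBl yu subr0 RRe_real ?normr_real// ltxx.
- by rewrite inner0l.
- by rewrite innerPl Mx// My// mulr0 addr0.
Qed.

(** Otherwise moving [m] inside [M] along a vector [u], by the projection of
    [x - m] on the line of [u], would decrease the distance to [x]. *)
Lemma minimizer_orthogonal M x m : closed_subspace M -> M m ->
  (forall u, M u -> rnorm (x - m) <= rnorm (x - u)) ->
  orthogonal_to M (x - m).
Proof.
move=> [_ M0 MD] Mm minm u Mu.
have [->|u0] := eqVneq u 0; first by rewrite inner0r.
have u2_gt0 : 0 < `|u| ^+ 2 :> R[i] by rewrite exprn_gt0 // normr_gt0.
pose a := inner H (x - m) u / `|u| ^+ 2.
have Mv : M (a *: u + m) by apply: MD.
have := minm _ Mv.
rewrite -lecR -!rnormE -(@ler_pXn2r _ 2) ?nnegrE// opprD addrA addrAC.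
rewrite -/a norm_sub_proj// lerBrDl gerDr.
rewrite pmulr_lle0 ?invr_gt0// le_eqVlt le_gtF ?exprn_ge0//= orbF.
by rewrite expf_eq0/= normr_eq0 => /eqP.
Qed.

(** By the parallelogram law for [x - m1] and [x - m2]: their half-sum is the
    difference of [x] and the midpoint of [m1] and [m2], which is in [M], hence
    has norm at least [d]. *)
Lemma near_minimizers_close M x (d : R) m1 m2 e : closed_subspace M ->
  (forall u, M u -> d <= rnorm (x - u)) -> 0 <= d ->
  M m1 -> M m2 -> rnorm (x - m1) <= d + e -> rnorm (x - m2) <= d + e ->
  rnorm (m1 - m2) ^+ 2 <= 4 * (2 * d * e + e ^+ 2).
Proof.
move=> [_ M0 MD] dM d0 Mm1 Mm2 xm1 xm2.
have h := parallelogram (x - m1) (x - m2).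
have Mmid : M (2^-1 *: (m1 + m2)).
  have Ms : M (m1 + m2) by rewrite -[m1]scale1r; exact: MD.
  by rewrite -[X in M X]addr0; exact: MD.
have mid : rnorm (x - m1 + (x - m2)) ^+ 2
             = 4 * rnorm (x - 2^-1 *: (m1 + m2)) ^+ 2.
  have -> : x - m1 + (x - m2) = 2%:R *: (x - 2^-1 *: (m1 + m2)).
    rewrite scalerBr scalerA mulfV ?pnatr_eq0// scale1r scaler_nat mulr2n.
    by rewrite opprD addrACA.
  by rewrite rnormZ_sqr normr_nat /=; ring.
have diff : rnorm (x - m1 - (x - m2)) = rnorm (m1 - m2).
  by rewrite rnorm_distC opprB addrC subrKA.
rewrite mid diff in h.
have := dM _ Mmid; have := rnorm_ge0 (x - m1); have := rnorm_ge0 (x - m2).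
move: h xm1 xm2.
move: (rnorm (m1 - m2)) (rnorm (x - m1)) (rnorm (x - m2)) (rnorm _).
move=> r p q s h pe qe q0 p0 ds.
have hp : p ^+ 2 <= (d + e) ^+ 2 by rewrite ler_sqr ?nnegrE//; lra.
have hq : q ^+ 2 <= (d + e) ^+ 2 by rewrite ler_sqr ?nnegrE//; lra.
have hs : d ^+ 2 <= s ^+ 2 by rewrite ler_sqr ?nnegrE//; lra.
nra.
Qed.

(** The points of [M] whose distance to [x] is close to the infimum form a
    Cauchy filter, and its limit is in [M]. *)
Lemma exists_minimizer M x : closed_subspace M ->
  exists2 m, M m & forall u, M u -> rnorm (x - m) <= rnorm (x - u).
Proof.
move=> MS; have [cM M0 MD] := MS.
pose D := [set rnorm (x - u) | u in M].
have infD : has_inf D.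
  split; first by exists (rnorm (x - 0)), 0.
  by exists 0 => _ [u _ <-]; exact: rnorm_ge0.
pose d := inf D.
have dM u : M u -> d <= rnorm (x - u).
  by move=> Mu; apply: ge_inf; [exact: infD.2|exists u].
have d0 : 0 <= d.
  by apply: lb_le_inf => [|_ [u _ <-]]; [exact: infD.1|exact: rnorm_ge0].
pose B e := [set u | M u /\ rnorm (x - u) < d + e].
have B0 e : 0 < e -> B e !=set0.
  by move=> e0; have [_ [u Mu <-] ud] := inf_adherent e0 infD; exists u.
pose F := filter_from [set e : R | 0 < e] B.
have FF : ProperFilter F.
  apply: filter_from_proper => //; apply: filter_from_filter; first by exists 1; exact: ltr01.
  move=> e1 e2 e10 e20; exists (Num.min e1 e2); first by rewrite /= lt_min e10.
  by move=> u [Mu]; rewrite addr_minr lt_min => /andP[ue1 ue2].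
have Fc : cauchy F.
  apply: cauchy_exP => c c0.
  have cE : c = (complex.Re c)%:C by rewrite RRe_real// gtr0_real.
  move: c0; rewrite cE ltcR; move: (complex.Re c) => r r0.
  (* For [e <= 1] the bound [4 * (2 * d * e + e ^+ 2)] is at most
     [(8 * d + 4) * e], which is less than [r ^+ 2]. *)
  pose e := Num.min 1 (r ^+ 2 / (8 * d + 5)).
  have d5 : 0 < 8 * d + 5 by lra.
  have e0 : 0 < e by rewrite /e lt_min ltr01 divr_gt0// exprn_gt0.
  have [m1 [Mm1 xm1]] := B0 e e0.
  exists m1, e => //= m2 [Mm2 xm2].
  rewrite -ball_normE /= rnormE ltcR -ltr_sqr ?nnegrE ?rnorm_ge0 ?(ltW r0)//.
  apply: le_lt_trans
    (near_minimizers_close MS dM d0 Mm1 Mm2 (ltW xm1) (ltW xm2)) _.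
  have e1 : e <= 1 by rewrite /e ge_min lexx.
  have : e * (8 * d + 5) <= r ^+ 2 by rewrite -ler_pdivlMr// /e ge_min lexx orbT.
  nra.
have /cvg_ex[m Fm] : cvg F by exact: cauchy_cvg.
have near_m e : 0 < e ->
    exists2 u, M u & rnorm (m - u) < e /\ rnorm (x - u) < d + e.
  move=> e0; have : F [set u | rnorm (m - u) < e].
    by apply: Fm; apply/nbhs_rnormP; exists e.
  move=> [e' e'0 Be'].
  have [|u [Mu]] := B0 (Num.min e e'); first by rewrite lt_min e0.
  rewrite addr_minr lt_min => /andP[xe xe'].
  by exists u => //; split=> //; apply: Be'.
exists m.
  by move/closed_rnormP: cM; apply=> e /near_m[u Mu []]; exists u.
move=> u /dM; apply: le_trans; apply/ler_addgt0Pr => e e0.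
have [|v Mv [mv xv]] := near_m (e / 2); first exact: divr_gt0.
by have := rnorm_triangle x v m; rewrite (rnorm_distC v m); lra.
Qed.

(** The projection theorem, in the only form used below: a proper closed
    subspace has a nonzero orthogonal vector. *)
Lemma orthogonal_nontrivial M : closed_subspace M -> M <> setT ->
  exists2 z, z != 0 & orthogonal_to M z.
Proof.
move=> MS MT.
have [x Mx] : exists x, ~ M x.
  by apply/existsNP => h; apply: MT; apply/seteqP; split.
have [m Mm minm] := exists_minimizer x MS.
exists (x - m); last exact: minimizer_orthogonal minm.
by rewrite subr_eq0; apply/eqP => xm; apply: Mx; rewrite xm.
Qed.

(** A nonzero [f] is represented by a multiple of a vector [z] orthogonal to its
    kernel, as [x - (f x / f z) *: z] is in the kernel. *)
Lemma riesz (f : H -> R[i]) :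
  (forall a x y, f (a *: x + y) = a * f x + f y) ->
  closed [set x | f x = 0] -> exists z, forall x, f x = inner H x z.
Proof.
move=> fL cf.
have f0 : f 0 = 0.
  have := fL 1 0 0; rewrite scaler0 addr0 mul1r => /eqP.
  by rewrite addrC -subr_eq subrr => /eqP.
have KS : closed_subspace [set x | f x = 0].
  by split=> // a x y /= fx fy; rewrite fL fx fy mulr0 addr0.
have [KT|/(orthogonal_nontrivial KS)[z z0 zK]] :=
    pselect ([set x | f x = 0] = setT).
  by exists 0 => x; rewrite inner0r; rewrite -[f x = 0]/([set x | f x = 0] x) KT.
have fz : f z != 0.
  by apply: contra_neq z0 => fz; apply/inner_eq0/zK.
have zz : inner H z z != 0 by apply: contra_neq z0 => /inner_eq0.
exists ((f z / inner H z z)^*%R *: z) => x.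
rewrite innerZr conjCK.
have : inner H z (x - (f x / f z) *: z) = 0.
  apply: zK => /=; rewrite addrC -scaleNr fL mulNr divfK// addNr //.
rewrite inner_conj => /eqP; rewrite conjC_eq0 innerBl innerZl subr_eq0.
by move=> /eqP ->; field; rewrite zz fz.
Qed.

Lemma adjoint_exists (A : bounded_op H) : exists B, is_adjoint A B.
Proof.
have h y : exists z, forall x, inner H (A x) y = inner H x z.
  apply: riesz => [a x x'|]; first by rewrite linearP innerPl.
  have -> : [set x | inner H (A x) y = 0] = A @^-1` orthogonal_to [set y].
    by apply/seteqP; split=> x /= xy; [move=> _ ->|exact: xy].
  apply: closed_comp => [x _|].
    exact/(linear_bounded_continuous A).1/op_bounded.
  by have [] := closed_subspace_orthogonal [set y].
by have [B BP] := choice h; exists B => x y; apply: BP.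
Qed.

Lemma adjointE (A : H -> H) : (exists B, is_adjoint A B) ->
  is_adjoint A (adjoint A).
Proof. by move=> [B AB]; apply: (@getPex _ (is_adjoint A)); exists B. Qed.

Lemma adjoint_unique (A B : H -> H) : is_adjoint A B -> adjoint A = B.
Proof.
move=> AB; have AA : is_adjoint A (adjoint A) by apply: adjointE; exists B.
apply/funext => y; apply/eqP; rewrite -subr_eq0; apply/eqP/inner_eq0.
by rewrite innerBr -AA AB subrr.
Qed.

Lemma adjoint_linear (A B : H -> H) : is_adjoint A B ->
  forall (a : R[i]) x y, B (a *: x + y) = a *: B x + B y.
Proof.
move=> AB a x y; apply/eqP; rewrite -subr_eq0; apply/eqP/inner_eq0.
set d := _ - _.
by rewrite innerBr innerDr innerZr -!AB innerDr innerZr subrr.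
Qed.

End HilbertSpace.

(** * Sums of nonnegative extended reals *)

Section ExtendedSums.
Set Implicit Arguments.
Unset Strict Implicit.
Variables (R : realType) (I : choiceType).

Lemma esumZ_le (D : set I) (f : I -> \bar R) (c : R) :
  0 <= c -> (forall i, 0 <= f i)%E ->
  (\esum_(i in D) (c%:E * f i) <= c%:E * \esum_(i in D) f i)%E.
Proof.
move=> c0 f0; apply: ge_ereal_sup => _ [X XD <-].
rewrite -ge0_mule_fsumr//; apply: lee_wpmul2l; first by rewrite lee_fin.
by apply: ereal_sup_ubound; exists X.
Qed.

Lemma esum_words_cons (a : seq I -> \bar R) k : (forall w, 0 <= a w)%E ->
  \esum_(w in [set w | size w = k.+1]) a w =
  \esum_(i in setT) \esum_(w in [set w | size w = k]) a (i :: w).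
Proof.
move=> a0; rewrite esum_esum//.
apply: (reindex_esum _ _ (fun p => p.1 :: p.2)); split=> [p [_ /= ->]//||].
  by move=> [i w] [j v] _ _ [/= -> ->].
by move=> [//|i w] /= [wk]; exists (i, w).
Qed.

Lemma esum_fset_le (f : I -> R) (c : R) :
  (forall A : {fset I}, \sum_(i <- A) f i <= c) ->
  (\esum_(i in setT) (f i)%:E <= c%:E)%E.
Proof.
move=> fc; apply: ge_ereal_sup => _ [X [finX _] <-].
by rewrite fsbig_finite//= sumEFin lee_fin.
Qed.

Lemma ge_esum_term (f : I -> \bar R) i : (forall j, 0 <= f j)%E ->
  (f i <= \esum_(j in setT) f j)%E.
Proof.
by move=> f0; apply: esum_ge; exists [set i]; [|rewrite fsbig_set1].
Qed.
End ExtendedSums.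

(** * The sums over the words of a given length *)

Section Words.
Set Implicit Arguments.
Unset Strict Implicit.
Local Open Scope complex_scope.

Variables (R : realType) (H : hilbertType R) (n : option nat).
Variable T : gens n -> bounded_op H.
Implicit Types (x y h : H) (w : seq (gens n)).

Lemma adjoint_op (i : gens n) : is_adjoint (T i) (adjoint (T i)).
Proof. exact/adjointE/adjoint_exists. Qed.

Lemma adjoint_word w : is_adjoint (word_op T w) (adjoint (word_op T w)).
Proof.
apply: adjointE; elim: w => [|i w [B wB]]; first by exists id.
by exists (B \o adjoint (T i)) => x y /=; rewrite adjoint_op wB.
Qed.

Lemma adjoint_word_cons i w h :
  adjoint (word_op T (i :: w)) h = adjoint (word_op T w) (adjoint (T i) h).
Proof.
rewrite (@adjoint_unique _ _ _ (adjoint (word_op T w) \o adjoint (T i)))//.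
by move=> x y /=; rewrite adjoint_op adjoint_word.
Qed.

Lemma word_sum_ge0 h k : (0 <= word_sum T h k)%E.
Proof. by apply: esum_ge0 => w _; rewrite lee_fin sqr_ge0. Qed.

Lemma word_sum0 h : word_sum T h 0 = (rnorm h ^+ 2)%:E.
Proof.
rewrite /word_sum (_ : [set w | size w = 0%N] = [set [::]]); last first.
  by apply/seteqP; split=> w /=; [move/size0nil|move=> ->].
rewrite esum_set1 ?lee_fin ?sqr_ge0//.
by rewrite (@adjoint_unique _ _ _ id).
Qed.

Lemma word_sumS h k :
  word_sum T h k.+1 = \esum_(i in setT) word_sum T (adjoint (T i) h) k.
Proof.
rewrite /word_sum esum_words_cons => [|w]; last by rewrite lee_fin sqr_ge0.
apply: eq_esum => i _; apply: eq_esum => w _.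
by rewrite adjoint_word_cons.
Qed.

Lemma word_sum_adjoint_le i h k :
  (word_sum T (adjoint (T i) h) k <= word_sum T h k.+1)%E.
Proof.
rewrite word_sumS.
pose s j := word_sum T (adjoint (T j) h) k.
by apply: (@ge_esum_term _ _ s i) => j; exact: word_sum_ge0.
Qed.

(** Each word contributes [|u + v|^2 <= 2 |u|^2 + 2 |v|^2], with [u] and [v]
    the images of [a *: x] and [y]; the parallelogram law gives it. *)
Lemma word_sum_linear_le (a : R[i]) x y k :
  (word_sum T (a *: x + y)%R k <=
   (2 * complex.Re `|a| ^+ 2)%:E * word_sum T x k + 2%:E * word_sum T y k)%E.
Proof.
have a0 : 0 <= 2 * complex.Re `|a| ^+ 2 by rewrite mulr_ge0// sqr_ge0.
pose s h w := ((rnorm (adjoint (word_op T w) h)) ^+ 2)%:E.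
have s0 h w : (0 <= s h w)%E by rewrite lee_fin sqr_ge0.
apply: le_trans (leeD (esumZ_le _ a0 (s0 x)) (esumZ_le _ _ (s0 y))) => //.
rewrite -esumD; last 2 first.
- by move=> w _; apply: mule_ge0 (s0 _ _); rewrite lee_fin.
- by move=> w _; apply: mule_ge0 (s0 _ _); rewrite lee_fin.
apply: le_esum => w _; rewrite /s -!EFinM -EFinD lee_fin -/(rnorm _).
rewrite (adjoint_linear (adjoint_word w)) -mulrA -rnormZ_sqr -mulrDr.
by rewrite -parallelogram lerDl sqr_ge0.
Qed.

Hypothesis T_row : row_contraction T.

(** The sum over a finite set of indices is the real part of [<s h, h>], for the
    partial sum [s] of the [T_i T_i^*].  These real parts increase with the set
    and converge to the one of [<S h, h>]. *)
Lemma row_contraction_sum_le h :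
  (\esum_(i in setT) (rnorm (adjoint (T i) h) ^+ 2)%:E <= (rnorm h ^+ 2)%:E)%E.
Proof.
have [S Scvg SI] := T_row; apply: esum_fset_le => A.
pose s B := partial_sum (fun i => T i (adjoint (T i) h)) B.
have sE (B : {fset gens n}) :
    complex.Re (inner H (s B) h) = \sum_(i <- B) rnorm (adjoint (T i) h) ^+ 2.
  rewrite /s /partial_sum [RHS]big_seq_fsetE/=.
  rewrite (big_morph (fun u => complex.Re (inner H u h))
             (id1 := 0) (op1 := +%R)) ?inner0l//.
    by apply: eq_bigr => i _; rewrite (adjoint_op (val i) _ h) inner_rnorm.
  move=> u v; rewrite innerDl.
  by case: (inner H u h) (inner H v h) => [? ?] [? ?].
have Sh : complex.Re (inner H (S h) h) <= rnorm h ^+ 2.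
  have := SI h; rewrite innerBl subr_ge0 inner_rnorm lecE => /andP[_].
  by [].
apply/ler_addgt0Pr => e e0.
have [d d0 dP] := inner_small h e0.
have FF := @totally_filter (gens n).
have AF : totally [set B | (A `<=` B)%fset] by exists A.
have SF : totally [set B | rnorm (S h - s B) < d].
  have SN : nbhs (S h : H) [set y | rnorm (S h - y) < d].
    by apply/nbhs_rnormP; exists d.
  exact: (Scvg h _ SN).
have [B [AB /dP]] := filter_ex (filterI AF SF); rewrite innerBl => SB.
have AB_sum : \sum_(i <- A) rnorm (adjoint (T i) h) ^+ 2
    <= \sum_(i <- B) rnorm (adjoint (T i) h) ^+ 2.
  rewrite (big_fsetID _ (mem A) B)/=.
  rewrite (_ : [fset x | x in B & x \in A]%fset = A) ?lerDl ?sumr_ge0//.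
    by move=> i _; rewrite sqr_ge0.
  apply/fsetP => i; rewrite !inE andbC; case: (boolP (i \in A)) => //= iA.
  by rewrite (fsubsetP AB).
apply: le_trans AB_sum _; rewrite -sE.
have : complex.Re (inner H (s B) h) - complex.Re (inner H (S h) h) <= e.
  have := le_lt_trans (normc_ge_Re _) SB; rewrite ltcR ltr_norml.
  case: (inner H (S h) h) (inner H (s B) h) => [a b] [c b'] /=; lra.
lra.
Qed.

(** By induction on [k] for all [h] at once: the recursion on the first letter
    reduces the inequality to the same one for the vectors [T_i^* h]. *)
Lemma word_sumSn_le h k : (word_sum T h k.+1 <= word_sum T h k)%E.
Proof.
elim: k h => [|k IH] h.
  rewrite word_sumS word_sum0; apply: le_trans (row_contraction_sum_le h).
  by apply: le_esum => i _; rewrite word_sum0.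
by rewrite word_sumS [leRHS]word_sumS; apply: le_esum.
Qed.

Lemma word_sum_antitone h :
  {homo word_sum T h : k m / (k <= m)%N >-> (m <= k)%E}.
Proof. exact/nonincreasing_seqP/word_sumSn_le. Qed.

Lemma word_sum_le h k : (word_sum T h k <= (rnorm h ^+ 2)%:E)%E.
Proof. by rewrite -word_sum0; exact: word_sum_antitone. Qed.

(** For these nonincreasing sums this is the convergence to [0], in a form
    which needs a single [k] for each bound. *)
Definition decays h :=
  forall e : R, 0 < e -> exists k, (word_sum T h k <= e%:E)%E.

Lemma decays_cvg0 h : decays h -> word_sum T h k @[k --> \oo] --> 0%E.
Proof.
move=> hd; have := ereal_nonincreasing_cvgn (@word_sum_antitone h).
suff -> : ereal_inf (range (word_sum T h)) = 0%E by [].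
apply/eqP; rewrite eq_le; apply/andP; split; last first.
  by apply: le_ereal_inf_tmp => _ [k _ <-]; exact: word_sum_ge0.
apply/lee_addgt0Pr => e /hd[k hk]; rewrite add0e; apply: le_trans hk.
by apply: ereal_inf_lbound; exists k.
Qed.

Lemma not_decays_lim h : ~ decays h ->
  exists2 l : \bar R, word_sum T h k @[k --> \oo] --> l & l != 0%E.
Proof.
move=> hd; exists (ereal_inf (range (word_sum T h))).
  exact/ereal_nonincreasing_cvgn/word_sum_antitone.
apply: contra_notN hd => /eqP inf0 e e0.
have : (ereal_inf (range (word_sum T h)) < e%:E)%E by rewrite inf0 lte_fin.
by move=> /ereal_inf_lt[_ [k _ <-] /ltW ke]; exists k.
Qed.

Lemma decays_adjoint i h : decays h -> decays (adjoint (T i) h).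
Proof.
move=> hd e /hd[k hk]; exists k.
exact: le_trans (le_trans (word_sum_adjoint_le i h k) (word_sumSn_le h k)) hk.
Qed.

(** For closedness, [x] is written [y + (x - y)] with [y] decaying and
    [x - y] small; the sums for [x - y] are at most [|x - y|^2] for all [k]. *)
Lemma closed_subspace_decays : closed_subspace [set h | decays h].
Proof.
split=> [|e e0|a x y xd yd e e0].
- apply/closed_rnormP => x xcl e e0.
  (* Then [d ^+ 2 <= e / 4], and each of the two terms of
     [word_sum_linear_le] is at most [e / 2]. *)
  pose d := Num.min 1 (e / 4).
  have d0 : 0 < d by rewrite lt_min ltr01 divr_gt0.
  have [y yd xy] := xcl d d0.
  have [k yk] := yd (e / 4) (divr_gt0 e0 (ltr0Sn _ 3)).
  exists k; rewrite -[x](subrK y) addrC -[y in y + _]scale1r.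
  apply: le_trans (word_sum_linear_le _ _ _ _) _.
  rewrite normr1 expr1n mulr1.
  have xk : (word_sum T (x - y)%R k <= (d ^+ 2)%:E)%E.
    apply: le_trans (word_sum_le _ _) _; rewrite lee_fin.
    by rewrite ler_sqr ?nnegrE ?rnorm_ge0 ?(ltW d0) ?(ltW xy).
  apply: (@le_trans _ _ (2%:E * (e / 4)%:E + 2%:E * (d ^+ 2)%:E)%E).
    by apply: leeD; apply: lee_wpmul2l.
  rewrite -!EFinM -EFinD lee_fin.
  have d1 : d <= 1 by rewrite ge_min lexx.
  have de : d <= e / 4 by rewrite ge_min lexx orbT.
  nra.
- exists 0%N; rewrite word_sum0 /rnorm normr0 expr0n/= lee_fin.
  exact: ltW.
- pose A := complex.Re `|a| ^+ 2.
  have A0 : 0 <= A by rewrite sqr_ge0.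
  pose d := e / (4 * (A + 1)).
  have d0 : 0 < d by apply: divr_gt0 => //; lra.
  have [k xk] := xd d d0; have [m ym] := yd d d0.
  exists (maxn k m); apply: le_trans (word_sum_linear_le _ _ _ _) _.
  apply: (@le_trans _ _ ((2 * A)%:E * d%:E + 2%:E * d%:E)%E).
    apply: leeD; apply: lee_wpmul2l.
    + by rewrite lee_fin mulr_ge0.
    + by apply: le_trans xk; apply: word_sum_antitone; exact: leq_maxl.
    + by rewrite lee_fin.
    + by apply: le_trans ym; apply: word_sum_antitone; exact: leq_maxr.
  rewrite -!EFinM -EFinD lee_fin.
  have : d * (4 * (A + 1)) = e by rewrite divfK//; lra.
  lra.
Qed.

End Words.

(** * The invariant subspace *)

Theorem corollary4p2 (R : realType) (H : hilbertType R) (n : option nat)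
    (n_gt0 : n <> Some 0%N) (T : gens n -> bounded_op H)
    (T_row : row_contraction T) (T_nC0 : ~ class_C0 T) (T_nC1 : ~ class_C1 T) :
  exists M : set H,
    [/\ closed_subspace M, M <> [set 0], M <> setT & joint_invariant T M].
Proof.
pose N := [set h | decays T h].
(* A vector that contradicts [class_C1] is in [N]. *)
have [h0 h0_neq0 Nh0] : exists2 h, h != 0 & N h.
  apply: contra_notP T_nC1 => /forall2NP hN h h_neq0.
  by apply: not_decays_lim => //; have [/(_ h_neq0)|] := hN h.
have NT : N <> setT.
  move=> NT; apply: T_nC0 => h; apply: decays_cvg0 => //.
  by have : N h by rewrite NT.
have [z z_neq0 zN] := orthogonal_nontrivial (closed_subspace_decays T_row) NT.
exists (orthogonal_to N); split.
- exact: closed_subspace_orthogonal.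
- by move=> N0; move: zN z_neq0; rewrite N0 => ->; rewrite eqxx.
- move=> NperpT; move/eqP: h0_neq0; apply; apply: inner_eq0.
  by have /(_ h0 Nh0) : orthogonal_to N h0 by rewrite NperpT.
- move=> i x xN h hd; rewrite adjoint_op; apply: xN.
  exact: decays_adjoint.
Qed.
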